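(* Let $G=(V,E,w)$ be a finite connected graph with $|V|=n\ge 2$ and weights $w:E\to\mathbb{R}_{>0}$, and let $d_G$ be its unit-length shortest-path metric. Let $u$ be an ultrametric on $V$ satisfying $u(x,y)\ge d_G(x,y)$ for all $x,y\in V$. Then there exists a rooted binary hierarchical tree $T$ on $V$ such that: (1) every cluster of $T$ induces a connected subgraph of $G$; (2) $u_T^{\mathrm{diam}}$ is an ultrametric dominating $d_G$, i.e. $u_T^{\mathrm{diam}}(x,y)\ge d_G(x,y)$ for all $x,y\in V$; (3) for every edge $xy\in E$, $u_T^{\mathrm{diam}}(x,y)\le u(x,y)$. Consequently, $$\sum_{xy\in E}w_{xy}\,u_T^{\mathrm{diam}}(x,y)\le\sum_{xy\in E}w_{xy}\,u(x,y).$$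
   Context: $d_G$ is the shortest-path metric of the support graph $(V,E)$ with every edge of length $1$; the weights $w$ are not edge lengths. An ultrametric on $V$ is a metric $u:V\times V\to\mathbb{R}_{\ge0}$ with $u(x,y)\le\max\{u(x,z),u(z,y)\}$ for all $x,y,z\in V$. A hierarchical tree $T$ on $V$ is a rooted tree whose leaves are the vertices of $V$; it is binary if every internal node has exactly two children. Every node is identified with the set of leaves in its subtree, called a cluster. For $x,y\in V$, $C_T(x,y)$ is the cluster of the lowest common ancestor of $x$ and $y$. For $S\subseteq V$, $\operatorname{diam}_{d_G}(S)=\max_{a,b\in S}d_G(a,b)$. The diameter labeling is $u_T^{\mathrm{diam}}(x,x)=0$ and $u_T^{\mathrm{diam}}(x,y)=\operatorname{diam}_{d_G}(C_T(x,y))$ for $x\ne y$. *)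

(* Defs.v *)
From mathcomp Require Import all_boot all_order all_algebra.
From mathcomp Require Import reals.

Set Implicit Arguments.
Unset Strict Implicit.
Unset Printing Implicit Defensive.

Import Order.TTheory GRing.Theory Num.Theory.

Section Graph.
Variables (V : finType) (e : rel V).

Definition walk_of_length (x y : V) (k : nat) : bool :=
  [exists p : k.-tuple V, path e x p && (last x p == y)].

(* The minimum ranges over k < #|V| only, since shortest paths do not repeat
   vertices; #|V| is a junk value for x and y in distinct components. The
   lemmas gdist_path and gdist_min characterize gdist without this bound. *)
Definition gdist (x y : V) : nat :=
  \big[minn/#|V|]_(k < #|V| | walk_of_length x y k) k.

Definition gdiam (S : {set V}) : nat :=
  \max_(a in S) \max_(b in S) gdist a b.

Definition induced (S : {set V}) : rel V :=
  [rel a b | [&& a \in S, b \in S & e a b]].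

Definition induces_connected (S : {set V}) : Prop :=
  {in S &, forall x y, connect (induced S) x y}.

Lemma gdist_min x p : path e x p -> gdist x (last x p) <= size p.
Proof.
case/shortenP=> q eq Uq sub_qp; set y := last x q.
apply: (@leq_trans (size q)); last first.
  by apply: uniq_leq_size sub_qp; case/andP: Uq.
have lt_qV: size q < #|V|.
  by rewrite -[(size q).+1]/(size (x :: q)) -(card_uniqP Uq) max_card.
rewrite /gdist.
have: walk_of_length x y (Ordinal lt_qV).
  by apply/existsP; exists (in_tuple q); rewrite eq eqxx.
elim: (index_enum _) (mem_index_enum (Ordinal lt_qV)) => //= k r IHr.
rewrite inE big_cons => /orP[/eqP <- -> | r_k walk_k].
  exact: geq_minl.
case: ifP => _; last exact: IHr.
by rewrite geq_min IHr ?orbT.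
Qed.

Lemma gdist_path x y : connect e x y ->
  exists p, [/\ path e x p, last x p = y & size p = gdist x y].
Proof.
case/connectP=> p ep ->; have := gdist_min ep.
case/shortenP: ep => q eq Uq _ _; set y' := last x q.
have lt_dV: gdist x y' < #|V|.
  apply: leq_ltn_trans (gdist_min eq) _.
  by rewrite -[(size q).+1]/(size (x :: q)) -(card_uniqP Uq) max_card.
suff: (gdist x y' == #|V|) || walk_of_length x y' (gdist x y').
  rewrite (ltn_eqF lt_dV) /= => /existsP[t /andP[et /eqP lt]].
  by exists t; rewrite size_tuple.
rewrite {lt_dV} /gdist; elim/big_rec: _ => [|k m walk_k IHm]; first by rewrite eqxx.
by rewrite /minn; case: ifP; rewrite // walk_k orbT.
Qed.

End Graph.

Section HierarchicalTree.
Variable V : finType.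

(* Rooted binary trees with leaves labelled in V; the order in which the two
   children of a node are listed plays no role in what follows. *)
Inductive bintree : Type :=
  | Leaf of V
  | Node of bintree & bintree.

Fixpoint leaves (t : bintree) : seq V :=
  match t with
  | Leaf v => [:: v]
  | Node l r => leaves l ++ leaves r
  end.

(* Each vertex labels exactly one leaf. *)
Definition hierarchical (t : bintree) : Prop :=
  perm_eq (leaves t) (enum V).

Definition cluster (t : bintree) : {set V} := [set v in leaves t].

(* One entry per node: the subtree rooted there. *)
Fixpoint subtrees (t : bintree) : seq bintree :=
  t :: match t with
       | Leaf _ => [::]
       | Node l r => subtrees l ++ subtrees r
       end.

Definition clusters (t : bintree) : seq {set V} :=
  [seq cluster s | s <- subtrees t].

(* The subtree rooted at the lowest common ancestor of the leaves x and y,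
   assuming that x and y are leaves of t. *)
Fixpoint lca (t : bintree) (x y : V) : bintree :=
  match t with
  | Leaf _ => t
  | Node l r =>
      if (x \in leaves l) && (y \in leaves l) then lca l x y
      else if (x \in leaves r) && (y \in leaves r) then lca r x y
      else t
  end.

Definition lca_cluster (t : bintree) (x y : V) : {set V} :=
  cluster (lca t x y).

End HierarchicalTree.

Local Open Scope ring_scope.

Record is_metric (R : realType) (V : Type) (d : V -> V -> R) : Prop := {
  metric_ge0 : forall x y, 0 <= d x y;
  metric_eq0 : forall x y, d x y = 0 <-> x = y;
  metric_sym : forall x y, d x y = d y x;
  metric_triangle : forall x y z, d x y <= d x z + d z y
}.

Definition is_ultrametric (R : realType) (V : Type) (u : V -> V -> R) : Prop :=
  is_metric u /\ forall x y z, u x y <= Num.max (u x z) (u z y).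

Definition dominates (R : realType) (V : finType) (e : rel V)
    (u : V -> V -> R) : Prop :=
  forall x y, (gdist e x y)%:R <= u x y.

Definition diam_label (R : realType) (V : finType) (e : rel V)
    (t : bintree V) (x y : V) : R :=
  if x == y then 0 else (gdiam e (lca_cluster t x y))%:R.

(* For symmetric e, w and f, the sum over unordered edges: the comparison of
   ranks selects one of the two orientations of each edge. *)
Definition edge_sum (R : realType) (V : finType) (e : rel V)
    (w f : V -> V -> R) : R :=
  \sum_(x : V) \sum_(y : V | e x y && (enum_rank x < enum_rank y)%N)
    w x y * f x y.

(* Main.v *)
Require Import Defs.
From mathcomp Require Import all_boot all_order all_algebra.
From mathcomp Require Import reals.

(** The tree is built top down. Let S be a connected set with at least two
    vertices and D its diameter, attained at (a, b). Since u dominates the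
    distance, u a b >= D, so by the ultrametric inequality a and b are not
    linked by edges of S with u < D. Let A be the component of a for these light
    edges, and B the component of b in S \ A. Then B is connected; S \ B is
    connected, being A together with the other components of S \ A, each of which
    is adjacent to A; and an edge between B and S \ B must end in A, hence is not
    light. Splitting S into B and S \ B thus labels only edges with u >= D by D. *)

Set Implicit Arguments.
Unset Strict Implicit.
Unset Printing Implicit Defensive.

Import Order.TTheory GRing.Theory Num.Theory.
Local Open Scope ring_scope.

(** * Splitting a connected set along a subrelation of its edges *)

Section Connectivity.
Variables (V : finType) (e : rel V).
Hypothesis e_sym : symmetric e.
Implicit Types (S A B : {set V}) (x y z : V).

Lemma induced_sym S : symmetric (induced e S).
Proof. by move=> x y; rewrite /induced /= e_sym; case: (x \in S); case: (y \in S). Qed.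

Lemma sub_induced S A : A \subset S -> subrel (induced e A) (induced e S).
Proof.
by move=> /subsetP sAS x y /and3P[xA yA exy]; apply/and3P; split=> //; apply: sAS.
Qed.

Lemma induces_connected_root S r :
  {in S, forall x, connect (induced e S) x r} -> induces_connected e S.
Proof.
move=> conn_r x y xS yS; apply: connect_trans (conn_r x xS) _.
by rewrite (sym_connect_sym (induced_sym S)) conn_r.
Qed.

(** Every vertex of an [f]-path to [r] is itself in the component of [r], so the path survives in
    the induced subgraph. This serves both for [A], with the light edges, and for [B], with the
    edges inside [S :\: A]. *)
Lemma component_connected (f : rel V) r :
  symmetric f -> subrel f e -> induces_connected e [set x | connect f r x].
Proof.
move=> f_sym sub_fe; apply: (@induces_connected_root _ r) => x.
rewrite inE (sym_connect_sym f_sym) => /connectP[p].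
elim: p x => [|y p IHp] x /=; first by move=> _ ->.
case/andP=> fxy fp lastr; apply: connect_trans (IHp y fp lastr).
have r_y: connect f r y.
  by rewrite (sym_connect_sym f_sym); apply/connectP; exists p.
apply: connect1; apply/and3P; split; rewrite ?inE //; last exact: sub_fe.
by apply: connect_trans r_y (connect1 _); rewrite f_sym.
Qed.

Lemma connected_split (f : rel V) S a b :
    symmetric f -> subrel f (induced e S) -> induces_connected e S ->
    a \in S -> b \in S -> ~~ connect f a b ->
  exists B : {set V}, [/\ B \subset S, a \notin B, b \in B,
    induces_connected e B /\ induces_connected e (S :\: B)
    & forall x y, x \in B -> y \in S :\: B -> ~~ f x y].
Proof.
move=> f_sym sub_f connS aS bS not_ab.
pose A := [set x | connect f a x]; pose B := [set x | connect (induced e (S :\: A)) b x].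
have bSA: b \in S :\: A by rewrite !inE not_ab.
have sub_B x : x \in B -> x \in S :\: A.
  rewrite inE (sym_connect_sym (induced_sym _)) => /connectP[[_ /= <- //|y p]] /=.
  by case/andP=> /and3P[].
(* [B] is a full component of [S :\: A], so edges leaving [B] inside [S] can only reach [A]. *)
have B_closed x y : x \in S :\: A -> y \in B -> e x y -> x \in B.
  move=> xSA yB exy; rewrite inE; move: (yB); rewrite inE => /connect_trans-> //.
  by apply/connect1/and3P; split; rewrite ?(sub_B y) // e_sym.
have sAS: A \subset S.
  apply/subsetP=> x; rewrite inE (sym_connect_sym f_sym) => /connectP[[_ /= <- //|y p]] /=.
  by case/andP=> /sub_f/and3P[].
have sASB: A \subset S :\: B.
  apply/subsetP=> x xA; rewrite inE (subsetP sAS) // andbT.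
  by apply/negP=> /sub_B; rewrite inE xA.
have connA: induces_connected e A.
  by apply: component_connected => // x y /sub_f/and3P[].
have aA: a \in A by rewrite inE connect0.
exists B; split.
- by apply/subsetP=> x /sub_B; rewrite inE => /andP[].
- by have:= subsetP sASB a aA; rewrite inE => /andP[].
- by rewrite inE connect0.
- split; first by apply: component_connected (induced_sym _) _ => x y /and3P[].
  apply: (@induces_connected_root _ a) => x xSB.
  have xS: x \in S by move: xSB; rewrite inE => /andP[].
  (* Follow a path in [S] from [x] to [a] as long as it avoids [B]. If the next vertex is in [B],
     the current one must be in [A], and the rest of the path is replaced by one inside [A]. *)
  case/connectP: (connS x a xS aS) => p.
  elim: p x xSB {xS} => [|y p IHp] x xSB /=; first by move=> _ ->.
  case/andP=> /and3P[xS yS exy] ep lasta.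
  have [yB|yNB] := boolP (y \in B); last first.
    have ySB: y \in S :\: B by rewrite inE yNB.
    apply: connect_trans (IHp y ySB ep lasta).
    by apply/connect1/and3P; split.
  have xA: x \in A.
    apply: contraLR xSB => xNA; rewrite inE xS andbT negbK.
    by apply: B_closed yB exy; rewrite inE xNA.
  apply: connect_sub (connA x a xA aA) => z t zt.
  exact/connect1/(sub_induced sASB).
(* If [y] were in [A], the [f]-edge would put [x] in [A] too; so [y] is in [S :\: A], and being
   adjacent to [B] it lies in [B]. *)
move=> x y xB; rewrite inE => /andP[yNB yS]; apply: contra yNB => fxy.
have /and3P[_ _ exy] := sub_f _ _ fxy.
apply: B_closed (xB) _; last by rewrite e_sym.
rewrite inE yS andbT; move: (sub_B x xB); rewrite !inE => /andP[NAx _].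
by apply: contra NAx => /connect_trans-> //; apply: connect1; rewrite f_sym.
Qed.

End Connectivity.

(** * Distances and diameters of vertex sets *)

Section Diameter.
Variables (V : finType) (e : rel V).
Hypothesis e_conn : forall x y : V, connect e x y.
Implicit Types (S : {set V}) (x y : V).

Lemma gdist_gt0 x y : x != y -> (0 < gdist e x y)%N.
Proof.
have [p [_ <- <-]] := gdist_path (e_conn x y).
by case: p => //=; rewrite eqxx.
Qed.

Lemma gdistxx x : gdist e x x = 0%N.
Proof. by apply/eqP; rewrite -leqn0 (@gdist_min _ e x [::]). Qed.

Lemma gdist_le_gdiam S x y : x \in S -> y \in S -> (gdist e x y <= gdiam e S)%N.
Proof.
by move=> xS yS; apply: (bigop.bigmax_sup x) => //; apply: (bigop.bigmax_sup y).
Qed.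

Lemma gdiamS S1 S2 : S1 \subset S2 -> (gdiam e S1 <= gdiam e S2)%N.
Proof.
move=> /subsetP sS; apply/bigop.bigmax_leqP=> x /sS xS; apply/bigop.bigmax_leqP=> y /sS yS.
exact: gdist_le_gdiam.
Qed.

Lemma gdiam_attained S : S != set0 ->
  exists a b, [/\ a \in S, b \in S & gdist e a b = gdiam e S].
Proof.
rewrite -card_gt0 => S_gt0; rewrite /gdiam.
have [a aS ->] := bigop.eq_bigmax_cond (fun a => \max_(b in S) gdist e a b)%N S_gt0.
have [b bS ->] := bigop.eq_bigmax_cond (gdist e a) S_gt0.
by exists a, b.
Qed.

End Diameter.

(** * Clusters of lowest common ancestors *)

Section LowestCommonAncestor.
Variable V : finType.
Implicit Types (t l r : bintree V) (x y z : V).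

Lemma in_cluster t x : (x \in cluster t) = (x \in leaves t).
Proof. by rewrite inE. Qed.

Lemma lca_sym t x y : lca t x y = lca t y x.
Proof.
by elim: t => //= l -> r ->; rewrite ![(x \in _) && _]andbC.
Qed.

Lemma mem_lca t x y : x \in leaves t -> y \in leaves t ->
  (x \in lca_cluster t x y) && (y \in lca_cluster t x y).
Proof.
rewrite /lca_cluster !in_cluster.
elim: t => [v|l IHl r IHr] /= xt yt; first by rewrite xt yt.
case: ifP => [/andP[]|_]; first exact: IHl.
by case: ifP => [/andP[]|_]; [exact: IHr | rewrite /= xt yt].
Qed.

Lemma lca_cluster_sub t x y : lca_cluster t x y \subset cluster t.
Proof.
rewrite /lca_cluster; elim: t => [//|l IHl r IHr] /=.
case: ifP => _; first by apply: subset_trans IHl _; apply/subsetP=> z; rewrite !inE mem_cat => ->.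
case: ifP => _ //.
by apply: subset_trans IHr _; apply/subsetP=> z; rewrite !inE mem_cat orbC => ->.
Qed.

(** If all three leaves are in one child, recurse. Otherwise the root separates [z] from [x] or from
    [y], and the cluster of that pair is the whole of [cluster t]. Uniqueness of the leaves makes
    the two sides exclusive. *)
Lemma lca_cluster_ultra t x y z : uniq (leaves t) ->
    x \in leaves t -> y \in leaves t -> z \in leaves t ->
  (lca_cluster t x y \subset lca_cluster t x z)
    || (lca_cluster t x y \subset lca_cluster t z y).
Proof.
elim: t => [v|l IHl r IHr]; first by rewrite /lca_cluster subxx.
have sub_t v1 v2 := lca_cluster_sub (Node l r) v1 v2.
move=> /= /[dup] Ut; rewrite cat_uniq => /and3P[Ul /hasPn disj Ur].
have excl v : v \in leaves l -> v \in leaves r -> False by move=> vl /disj; rewrite vl.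
have clN v1 v2 : (v1 \in leaves l) && (v2 \in leaves l) = false ->
    (v1 \in leaves r) && (v2 \in leaves r) = false ->
    lca_cluster (Node l r) v1 v2 = cluster (Node l r).
  by rewrite /lca_cluster /= => -> ->.
have clL v1 v2 : v1 \in leaves l -> v2 \in leaves l ->
    lca_cluster (Node l r) v1 v2 = lca_cluster l v1 v2.
  by rewrite /lca_cluster /= => -> ->.
have clR v1 v2 : v1 \in leaves r -> v2 \in leaves r ->
    lca_cluster (Node l r) v1 v2 = lca_cluster r v1 v2.
  rewrite /lca_cluster /= => v1r v2r; rewrite v1r v2r.
  by case: ifP => // /andP[/excl/(_ v1r)].
have side v : v \in leaves l ++ leaves r ->
    (v \in leaves l) = ~~ (v \in leaves r).
  rewrite mem_cat; case vl: (v \in leaves l); case vr: (v \in leaves r) => //.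
  by case: (excl v).
move=> xt yt zt; have := (side _ xt, side _ yt, side _ zt).
case xr: (x \in leaves r); case yr: (y \in leaves r); case zr: (z \in leaves r) => -[[xl yl] zl].
- by rewrite !clR ?IHr.
- by rewrite (clN x z) ?sub_t ?xl ?xr ?zr.
- by rewrite (clN z y) ?sub_t ?orbT ?yl ?yr ?zl ?zr.
- by rewrite (clN x z) ?sub_t ?xl ?xr ?zr.
- by rewrite (clN x z) ?sub_t ?xl ?xr ?zl ?zr.
- by rewrite (clN z y) ?sub_t ?orbT ?yl ?yr ?zl ?zr.
- by rewrite (clN x z) ?sub_t ?xl ?xr ?zl ?zr.
- by rewrite !clL ?IHl.
Qed.

End LowestCommonAncestor.

(** * The diameter labeling is an ultrametric dominating the distance *)

Section DiameterLabel.
Variables (R : realType) (V : finType) (e : rel V) (t : bintree V).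
Hypotheses (e_conn : forall x y : V, connect e x y) (t_hier : hierarchical t).

Let leavesT x : x \in leaves t.
Proof. by rewrite (perm_mem t_hier) mem_enum. Qed.

Lemma gdist_le_lca x y : (gdist e x y <= gdiam e (lca_cluster t x y))%N.
Proof.
by have /andP[? ?] := mem_lca (leavesT x) (leavesT y); apply: gdist_le_gdiam.
Qed.

Lemma diam_label_ge0 x y : 0 <= diam_label R e t x y.
Proof. by rewrite /diam_label; case: ifP => _; rewrite ?ler0n. Qed.

Lemma diam_label_dominates : dominates e (diam_label R e t).
Proof.
move=> x y; rewrite /diam_label; case: eqP => [->|_]; first by rewrite gdistxx.
by rewrite ler_nat gdist_le_lca.
Qed.

Lemma diam_label_max x y z :
  diam_label R e t x y <= Num.max (diam_label R e t x z) (diam_label R e t z y).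
Proof.
(* When [z] is an endpoint, one term of the maximum is the left-hand side itself; this removes the
   diagonal value 0, after which nested clusters give ordered diameters. *)
have [<-|xz] := eqVneq x z; first by rewrite le_max lexx orbT.
have [->|zy] := eqVneq z y; first by rewrite le_max lexx.
rewrite {1}/diam_label; case: eqP => [_|_]; first by rewrite le_max diam_label_ge0.
rewrite /diam_label (negPf xz) (negPf zy) le_max !ler_nat.
have Ut: uniq (leaves t) by rewrite (perm_uniq t_hier) enum_uniq.
by case/orP: (lca_cluster_ultra Ut (leavesT x) (leavesT y) (leavesT z)) => /(gdiamS e)->;
  rewrite ?orbT.
Qed.

Lemma diam_label_ultrametric : is_ultrametric (diam_label R e t).
Proof.
split; last exact: diam_label_max.
split=> [|x y|x y|x y z]; first exact: diam_label_ge0.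
- split=> [|->]; last by rewrite /diam_label eqxx.
  (* Distinct points have positive distance, which the diameter of their cluster bounds from above,
     so their label is nonzero. *)
  rewrite /diam_label; case: eqP => // /eqP /(gdist_gt0 e_conn) d_gt0 /eqP.
  by rewrite pnatr_eq0 -leqn0 leqNgt (leq_trans d_gt0) ?gdist_le_lca.
- by rewrite /diam_label eq_sym /lca_cluster lca_sym.
- apply: le_trans (diam_label_max x y z) _.
  by rewrite ge_max lerDl lerDr !diam_label_ge0.
Qed.

End DiameterLabel.

(** * Building the tree from the ultrametric *)

Section Construction.
Variables (R : realType) (V : finType) (e : rel V) (u : V -> V -> R).
Hypotheses (e_sym : symmetric e) (e_conn : forall x y : V, connect e x y).
Hypotheses (u_ultra : is_ultrametric u) (u_dom : dominates e u).
Implicit Type S : {set V}.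

Lemma ultrametric_split S : induces_connected e S -> (1 < #|S|)%N ->
  exists B : {set V}, [/\ B \subset S, B != set0, S :\: B != set0,
    induces_connected e B /\ induces_connected e (S :\: B)
    & forall x y, x \in B -> y \in S :\: B -> e x y -> (gdiam e S)%:R <= u x y].
Proof.
case: u_ultra => -[u_ge0 u_eq0 u_sym _] u_max connS S_gt1.
have D_gt0: (0 < gdiam e S)%N.
  have /card_gt1P[x [y [xS yS xy]]] := S_gt1.
  exact: leq_trans (gdist_gt0 e_conn xy) (gdist_le_gdiam _ xS yS).
have [|a [b [aS bS abD]]] := @gdiam_attained _ e S.
  by rewrite -card_gt0 (leq_trans _ S_gt1).
pose f := [rel x y | induced e S x y && (u x y < (gdiam e S)%:R)].
have f_sym: symmetric f by move=> x y; rewrite /f /= induced_sym // u_sym.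
(* The strong triangle inequality carries the strict bound along paths; the empty path, where
   [u x x] is 0, is what requires [D_gt0]. *)
have light x y : connect f x y -> u x y < (gdiam e S)%:R.
  case/connectP=> p; elim: p x => [|z p IHp] x /=.
    by move=> _ ->; rewrite (u_eq0 x x).2 // ltr0n.
  case/andP=> /andP[_ uxz] fp lasty.
  by apply: le_lt_trans (u_max x y z) _; rewrite gt_max uxz IHp.
have not_ab: ~~ connect f a b.
  by apply/negP=> /light; rewrite ltNge -abD u_dom.
have sub_f: subrel f (induced e S) by move=> x y /andP[].
have [B [sBS aB bB connB heavy]] := connected_split e_sym f_sym sub_f connS aS bS not_ab.
exists B; split=> //; first by apply/set0Pn; exists b.
  by apply/set0Pn; exists a; rewrite inE aB.
move=> x y xB ySB exy; have := heavy x y xB ySB; rewrite /f /induced /= exy (subsetP sBS x xB).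
by move: ySB; rewrite inE => /andP[_ ->]; rewrite -leNgt.
Qed.

(** Strong induction on [#|S|], both parts of the split being smaller than [S]. An edge inside a
    part keeps its label from the subtree; a crossing edge meets at the root and is labeled by the
    diameter of [S], which the split bounds by [u]. *)
Lemma ultrametric_tree S : S != set0 -> induces_connected e S ->
  exists t : bintree V, [/\ uniq (leaves t), cluster t = S,
    forall C, C \in clusters t -> induces_connected e C
    & forall x y, x \in S -> y \in S -> x != y -> e x y ->
        (gdiam e (lca_cluster t x y))%:R <= u x y].
Proof.
have u_sym := metric_sym (proj1 u_ultra).
have [n] := ubnP #|S|; elim: n S => // n IHn S ltSn S_neq0 connS.
have [S_le1|S_gt1] := leqP #|S| 1.
  have /cards1P[v defS]: #|S| == 1%N by rewrite eqn_leq S_le1 card_gt0.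
  have clv: cluster (Leaf v) = S by apply/setP=> x; rewrite defS !inE.
  exists (Leaf v); split=> // [C|x y].
    by rewrite /clusters /= clv inE => /eqP->.
  by rewrite defS !inE => /eqP-> /eqP->; rewrite eqxx.
have [B [sBS B_neq0 SB_neq0 [connB connSB] heavy]] := ultrametric_split connS S_gt1.
have cardS: (#|B| + #|S :\: B|)%N = #|S| by rewrite -(cardsID B S) (setIidPr sBS).
have [|l [Ul defB l_conn l_u]] := IHn B _ B_neq0 connB.
  by rewrite -ltnS; apply: leq_trans ltSn; rewrite ltnS -cardS -addn1 leq_add2l card_gt0.
have [|r [Ur defSB r_conn r_u]] := IHn (S :\: B) _ SB_neq0 connSB.
  by rewrite -ltnS; apply: leq_trans ltSn; rewrite ltnS -cardS -add1n leq_add2r card_gt0.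
have lE x : (x \in leaves l) = (x \in B) by rewrite -defB inE.
have rE x : (x \in leaves r) = (x \in S :\: B) by rewrite -defSB inE.
have defS: cluster (Node l r) = S.
  apply/setP=> x; rewrite inE /= mem_cat lE rE inE.
  by case: (boolP (x \in B)) => //= /(subsetP sBS)->.
exists (Node l r); split=> //.
- rewrite /= cat_uniq Ul Ur andbT /=; apply/hasPn=> x.
  by rewrite rE lE inE => /andP[].
- move=> C; rewrite /clusters /= inE map_cat mem_cat => /or3P[/eqP->||].
  + by rewrite defS.
  + exact: l_conn.
  + exact: r_conn.
move=> x y xS yS xy exy; rewrite /lca_cluster /= !lE !rE.
case: ifP => [/andP[xB yB]|NB]; first exact: l_u.
case: ifP => [/andP[xSB ySB]|NSB]; first exact: r_u.
rewrite defS; move: NB NSB; rewrite !inE xS yS !andbT.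
(* Only the two crossing cases remain; the second is the first with [x] and [y] exchanged. *)
case: (boolP (x \in B)) => xB; case: (boolP (y \in B)) => yB //= _ _.
  by apply: heavy; rewrite // inE yB.
by rewrite u_sym; apply: heavy; rewrite // ?inE ?xB // e_sym.
Qed.

End Construction.

Theorem lemma1 (R : realType) (V : finType) (e : rel V) (w u : V -> V -> R)
    (card_ge2 : (2 <= #|V|)%N)
    (e_sym : symmetric e) (e_irr : irreflexive e)
    (e_conn : forall x y : V, connect e x y)
    (w_sym : forall x y : V, e x y -> w x y = w y x)
    (w_gt0 : forall x y : V, e x y -> 0 < w x y)
    (u_ultra : is_ultrametric u)
    (u_dom : dominates e u) :
  exists T : bintree V,
    [/\ hierarchical T,
        forall S : {set V}, S \in clusters T -> induces_connected e S,
        is_ultrametric (diam_label R e T) /\ dominates e (diam_label R e T),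
        forall x y : V, e x y -> diam_label R e T x y <= u x y
      & edge_sum e w (diam_label R e T) <= edge_sum e w u].
Proof.
have V_neq0: [set: V] != set0 by rewrite -card_gt0 cardsT (leq_trans _ card_ge2).
have connV: induces_connected e [set: V].
  move=> x y _ _; apply: connect_sub (e_conn x y) => a b ab.
  by apply/connect1/and3P; split; rewrite ?inE.
have [T [UT defT T_conn T_u]] :=
  ultrametric_tree e_sym e_conn u_ultra u_dom V_neq0 connV.
have T_hier: hierarchical T.
  apply: uniq_perm (enum_uniq _) _ => // x.
  by rewrite mem_enum -in_cluster defT inE.
have T_le x y : e x y -> diam_label R e T x y <= u x y.
  move=> exy; rewrite /diam_label; case: eqVneq => [|xy].
    by move=> _; apply: (metric_ge0 (proj1 u_ultra)).
  exact: T_u.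
exists T; split=> //.
  by split; [exact: diam_label_ultrametric | exact: diam_label_dominates].
(* The edgewise bounds are scaled by positive weights and added. *)
apply: ler_sum => x _; apply: ler_sum => y /andP[exy _].
by apply: ler_wpM2l; rewrite ?T_le // ltW ?w_gt0.
Qed.
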